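(* Let $N$ be a positive integer, let $t_{\min}\le t_{\max}$ be real numbers, let $a_{is}$ ($1\le i\le N$, $0\le s\le N$) be real constants, and let $C_N:[t_{\min},t_{\max}]\to\mathbb{R}^N$ be the curve whose $i$-th component is $\sum_{s=0}^{N}a_{is}t^s$. Then every point in the convex hull of the image of $C_N$ can be represented as a convex combination of at most $\frac{N+1}{2}$ points on this curve if $N$ is odd, or as a convex combination of at most $\frac{N+2}{2}$ points on this curve if $N$ is even. Furthermore, if $N$ is even, one of these points on the curve can be required to be the point $C_N(t_{\min})$.
   Context: A convex combination is a finite sum $\sum_j c_j p_j$ with $c_j\ge 0$ and $\sum_j c_j=1$; coefficients are allowed to be zero (in particular, the coefficient of the required point $C_N(t_{\min})$ may be $0$). *)

(* Defs.v *)
From mathcomp Require Import all_boot all_order all_algebra.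
From mathcomp Require Import classical_sets reals.

Set Implicit Arguments.
Unset Strict Implicit.
Unset Printing Implicit Defensive.

Import Order.TTheory GRing.Theory Num.Theory.
Local Open Scope classical_set_scope.
Local Open Scope ring_scope.

(* The points need not be distinct and the weights may vanish, so a
   combination of a family of [k] points uses at most [k] distinct points. *)
Definition convex_combination (R : realType) (V : lmodType R) (k : nat)
    (p : 'I_k -> V) (x : V) : Prop :=
  exists c : 'I_k -> R,
    [/\ forall j, 0 <= c j, \sum_(j < k) c j = 1
      & x = \sum_(j < k) c j *: p j].

Definition convex_hull (R : realType) (V : lmodType R) (A : set V) : set V :=
  [set x | exists (k : nat) (p : 'I_k -> V),
             (forall j, A (p j)) /\ convex_combination p x].

Definition poly_curve (R : realType) (N : nat) (a : 'M[R]_(N, N.+1)) (t : R) :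
    'rV[R]_N :=
  \row_(i < N) \sum_(s < N.+1) a i s * t ^+ s.

(* Main.v *)
(* Passing to polynomials, one needs a quadrature rule with few nodes in the
   interval and nonnegative weights that agrees with a finitely supported
   positive measure on all polynomials of degree at most [N].  For odd
   [N = 2m - 1] this is Gauss quadrature: linear algebra gives [p <> 0] of
   degree at most [m] orthogonal to all polynomials of degree less than [m];
   either [p] vanishes on the support, which then has at most [m] points, or
   [p] has [m] distinct roots in the interval, and these are the nodes.  For
   even [N = 2m] it is Gauss-Radau quadrature, obtained by applying the odd
   case to the measure [(t - tmin) dmu] and adding the node [tmin]. *)
From HB Require Import structures.
Require Import Defs.
From mathcomp Require Import all_boot all_order all_algebra.
From mathcomp Require Import classical_sets set_interval reals.
From mathcomp Require Import boolp ring zify.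

Set Implicit Arguments.
Unset Strict Implicit.
Unset Printing Implicit Defensive.

Import Order.TTheory GRing.Theory Num.Theory.
Local Open Scope classical_set_scope.
Local Open Scope ring_scope.

(** * Sign changes and orthogonal polynomials *)

(** Induction on the degree: a polynomial taking both signs on the convex set [I] has a root there
    by the intermediate value theorem, and this root is split off. *)
Lemma poly_sign_factor (R : rcfType) (I : {pred R}) (p : {poly R}) :
  (forall x y z, x \in I -> y \in I -> x <= z <= y -> z \in I) -> p != 0 ->
  exists (s : seq R) (h : {poly R}),
    [/\ uniq s, {subset s <= I}, p = \prod_(x <- s) ('X - x%:P) * h
      & {in I, forall x, 0 <= h.[x]} \/ {in I, forall x, h.[x] <= 0}].
Proof.
move=> Iconv; have [n] := ubnP (size p); elim: n p => // n IH p szp p0.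
have [pos|npos] := pselect {in I, forall x, 0 <= p.[x]}.
  by exists [::], p; split=> //; [rewrite big_nil mul1r|left].
have [neg|nneg] := pselect {in I, forall x, p.[x] <= 0}.
  by exists [::], p; split=> //; [rewrite big_nil mul1r|right].
have [u uI pu] : exists2 u, u \in I & p.[u] < 0.
  apply: contrapT => H; apply: npos => x xI; rewrite leNgt; apply/negP => px.
  by apply: H; exists x.
have [v vI pv] : exists2 v, v \in I & 0 < p.[v].
  apply: contrapT => H; apply: nneg => x xI; rewrite leNgt; apply/negP => px.
  by apply: H; exists x.
have [z zI rz] : exists2 z, z \in I & root p z.
  case: (leP u v) => [uv|/ltW vu].
    have [|z zuv rz] := @poly_ivt _ p u v uv; first by rewrite !ltW.
    by exists z => //; apply: (Iconv u v).
  have [|z zuv rz] := @poly_ivt _ (- p) v u vu.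
    by rewrite !hornerN oppr_le0 oppr_ge0 !ltW.
  by exists z; [apply: (Iconv v u)|rewrite -rootN].
have [q qE] := factor_theorem _ _ rz.
have q0 : q != 0 by apply: contraNneq p0 => q0; rewrite qE q0 mul0r.
have szq : (size q < n)%N by move: szp; rewrite qE size_Mmonic ?monicXsubC //
    size_XsubC addn2.
have [s [h [us sI qsE hs]]] := IH q szq q0.
(* If [z] was already collected, both copies move into [h] as a square, which leaves its sign on [I]
   unchanged and keeps [s] duplicate-free. *)
have [zs|zs] := boolP (z \in s); last first.
  exists (z :: s), h; split=> //=; first by rewrite zs.
    by move=> x; rewrite inE => /predU1P[->//|/sI].
  by rewrite big_cons qE qsE; ring.
exists (rem z s), (('X - z%:P) ^+ 2 * h); split=> //.
- exact: rem_uniq.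
- by move=> x /mem_rem /sI.
- by rewrite qE qsE (perm_big _ (perm_to_rem zs)) big_cons /=; ring.
- case: hs => hs; [left|right] => x /hs hx; rewrite hornerM horner_exp.
    by rewrite mulr_ge0 ?sqr_ge0.
  by rewrite mulr_ge0_le0 ?sqr_ge0.
Qed.

(** Orthogonality to ['X^l] for [l < m] imposes [m] linear conditions on [m.+1] coefficients, so the
    Hankel matrix of moments has a nonzero left kernel vector. *)
Lemma orthogonal_poly_exists (R : fieldType) (L : {linear {poly R} -> R^o})
    (m : nat) :
  exists p : {poly R}, [/\ p != 0, (size p <= m.+1)%N
    & forall g : {poly R}, (size g <= m)%N -> L (p * g) = 0].
Proof.
pose A := \matrix_(k < m.+1, l < m) (L 'X^(k + l) : R).
have /rowV0Pn[v /sub_kermxP vA v0] : kermx A != 0.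
  rewrite kermx_eq0 -row_leq_rank -ltnNge ltnS; exact: rank_leq_col.
exists (rVpoly v); split.
- by apply: contraNneq v0 => pv; rewrite -[v]rVpolyK pv linear0.
- exact: size_poly.
move=> g szg.
have vl (l : 'I_m) : L (rVpoly v * 'X^l) = 0.
  have /rowP/(_ l) := vA; rewrite !mxE => vAl.
  rewrite -[RHS]vAl /rVpoly poly_def mulr_suml linear_sum.
  apply: eq_bigr => k _; rewrite mxE -scalerAl -exprD linearZ /=.
  by rewrite insubT //= => kP; congr (v _ _ *: _); apply: val_inj.
rewrite -[g](poly_rV_K szg) [rVpoly (poly_rV g)]/rVpoly poly_def mulr_sumr linear_sum.
by rewrite big1// => l _; rewrite -scalerAr linearZ /= vl scaler0.
Qed.

(** * Gauss and Gauss-Radau quadrature *)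

Section Quadrature.
Variables (R : rcfType) (n : nat) (c t : 'I_n -> R).

Definition quadrature (f : {poly R}) : R^o := \sum_j c j * f.[t j].

Fact quadrature_is_linear : linear quadrature.
Proof.
move=> k f g; rewrite /quadrature scaler_sumr -big_split /=.
by apply: eq_bigr => j _; rewrite hornerD hornerZ [_ *: _]mulrCA mulrDr.
Qed.
HB.instance Definition _ :=
  GRing.isLinear.Build R {poly R} R^o *:%R quadrature quadrature_is_linear.

End Quadrature.

(** Only atoms of nonzero weight must lie in [I]: the Radau rule applies this to a half-open
    interval, where atoms at the missing endpoint carry weight zero. *)
Lemma gauss_quadrature (R : rcfType) (I : {pred R}) (n m : nat)
    (c t : 'I_n -> R) :
  (forall x y z, x \in I -> y \in I -> x <= z <= y -> z \in I) ->
  (forall j, 0 <= c j) -> (forall j, c j != 0 -> t j \in I) ->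
  exists (s : seq R) (w : R -> R),
    [/\ uniq s, (size s <= m)%N, {subset s <= I},
        {in s, forall x, 0 <= w x}
      & forall f : {poly R}, (size f <= m + m)%N ->
          \sum_j c j * f.[t j] = \sum_(x <- s) w x * f.[x]].
Proof.
move=> Iconv c0 tI; pose L : {linear {poly R} -> R^o} := quadrature c t.
have [p [p0 szp pL]] := orthogonal_poly_exists L m.
have [s [h [us sI pE hs]]] := poly_sign_factor Iconv p0.
set q := \prod_(x <- s) _ in pE.
have qmon : q \is monic by apply: monic_prod_XsubC.
have szq : size q = (size s).+1 by rewrite size_prod_XsubC.
have h0 : h != 0 by apply: contraNneq p0 => h0; rewrite pE h0 mulr0.
have szpE : size p = (size s + size h)%N.
  by rewrite pE size_monicM// szq.
have h1 : (0 < size h)%N by rewrite size_poly_gt0.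
(* With fewer than [m] collected roots, [q] is an admissible test polynomial, so [L (p * q) = 0].
   Since [p * q = q ^+ 2 * h] has constant sign on [I], each term of this sum vanishes, and [p]
   vanishes at every atom of nonzero weight. *)
have [sm|sm] := ltnP (size s) m.
  have Lpq : L (p * q) = 0 by apply: pL; rewrite szq.
  have pt j : c j != 0 -> root p (t j).
    move=> cj; suff: (p * q).[t j] = 0.
      by rewrite pE !hornerM rootE hornerM => /eqP; rewrite !mulf_eq0 => /orP[->//|->].
    have pqE x : (p * q).[x] = q.[x] ^+ 2 * h.[x] by rewrite pE !hornerM; ring.
    have cpq0 : forall i, c i * (p * q).[t i] = 0.
      have termE i : c i * (p * q).[t i] = c i * q.[t i] ^+ 2 * h.[t i].
        by rewrite pqE mulrA.
      have cq i : 0 <= c i * q.[t i] ^+ 2 by rewrite mulr_ge0 ?sqr_ge0.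
      case: hs => hs i.
      - have pos k : 0 <= c k * (p * q).[t k].
          have [->|ck] := eqVneq (c k) 0; first by rewrite mul0r.
          by rewrite termE mulr_ge0 // hs // tI.
        have /eqP := Lpq; rewrite psumr_eq0 // => /allP /(_ i).
        by rewrite mem_index_enum => /(_ isT) /eqP.
      - have neg k : 0 <= - (c k * (p * q).[t k]).
          have [->|ck] := eqVneq (c k) 0; first by rewrite mul0r oppr0.
          by rewrite termE oppr_ge0 mulr_ge0_le0 // hs // tI.
        have /eqP := Lpq; rewrite -oppr_eq0 -sumrN psumr_eq0 // => /allP /(_ i).
        by rewrite mem_index_enum oppr_eq0 => /(_ isT) /eqP.
    by have /eqP := cpq0 j; rewrite mulf_eq0 (negPf cj) => /eqP.
  (* Coinciding atoms are merged and their weights added, so that the root count of [p] bounds the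
     number of nodes by [m]. *)
  pose atoms := undup [seq t j | j <- index_enum 'I_n & c j != 0].
  have atomP x : x \in atoms -> exists2 j, c j != 0 & x = t j.
    by rewrite mem_undup => /mapP[j]; rewrite mem_filter => /andP[cj _] ->; exists j.
  exists atoms, (fun x => \sum_(j | t j == x) c j); split.
  - exact: undup_uniq.
  - rewrite -ltnS (leq_trans _ szp) // max_poly_roots ?undup_uniq //.
    by apply/allP => x /atomP[j cj ->]; apply: pt.
  - by move=> x /atomP[j cj ->]; apply: tI.
  - by move=> x _; apply: sumr_ge0.
  move=> f _.
  under [RHS]eq_bigr => x _ do rewrite mulr_suml big_mkcond.
  rewrite exchange_big /=; apply: eq_bigr => j _.
  have [cj|cj] := eqVneq (c j) 0.
    by rewrite cj mul0r big1 // => x _; rewrite mul0r if_same.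
  rewrite (bigD1_seq (t j)) ?undup_uniq //=.
    by rewrite eqxx big1 ?addr0 // => x; rewrite eq_sym => /negPf ->.
  by rewrite mem_undup map_f // mem_filter cj mem_index_enum.
(* The bound on [size p] now forces [h] to be a nonzero constant, so [q] itself is orthogonal to all
   polynomials of size at most [m]. *)
have sm' : size s = m by lia.
have qL (g : {poly R}) : (size g <= m)%N -> L (q * g) = 0.
  move=> szg; have /size_poly1P[k k0 hk] : size h == 1%N by apply/eqP; lia.
  have := pL _ szg; rewrite pE hk mulrAC mulrC mul_polyC linearZ /=.
  by move=> /eqP; rewrite scaler_eq0 (negPf k0) => /eqP.
(* Lagrange basis at the nodes [s]. *)
pose l x := \prod_(y <- rem x s) ((x - y)^-1 *: ('X - y%:P)).
have szl x : x \in s -> (size (l x) <= m)%N.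
  move=> xs; rewrite /l scaler_prod (leq_trans (size_scale_leq _ _)) //.
  by rewrite size_prod_XsubC size_rem // -sm' prednK // -has_predT; apply/hasP; exists x.
have lE x y : x \in s -> y \in s -> (l x).[y] = (x == y)%:R.
  move=> xs ys; rewrite /l horner_prod; have [<-|xy] := eqVneq x y.
    rewrite big1_seq // => z /andP[_]; rewrite mem_rem_uniq // => /andP[/= zx _].
    by rewrite hornerZ hornerXsubC mulVf // subr_eq0 eq_sym.
  have yr : y \in rem x s by rewrite mem_rem_uniq // inE eq_sym xy.
  by rewrite (big_rem _ yr) /= hornerZ hornerXsubC subrr mulr0 mul0r.
have interp (f : {poly R}) : (size f <= m)%N -> f = \sum_(x <- s) f.[x] *: l x.
  move=> szf; apply/eqP; rewrite -subr_eq0; apply/eqP.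
  apply: (@roots_geq_poly_eq0 _ _ s) => //.
    apply/allP => y ys; rewrite rootE hornerD hornerN horner_sum.
    rewrite (bigD1_seq y) //= hornerZ lE // eqxx mulr1 big1_seq ?addr0 ?subrr //.
    by move=> x /andP[xy xs]; rewrite hornerZ lE // (negPf xy) mulr0.
  rewrite sm' (leq_trans (size_polyD _ _)) // geq_max szf size_polyN /=.
  rewrite big_seq; elim/big_rec: _ => [|x g xs szg]; first by rewrite size_poly0.
  rewrite (leq_trans (size_polyD _ _)) // geq_max szg andbT.
  exact: leq_trans (size_scale_leq _ _) (szl _ xs).
(* Divide [f] by [q]: the quotient has size at most [m], so its product with [q] is killed by [L].
   The remainder is interpolated, and it agrees with [f] at the nodes. *)
have quad (f : {poly R}) : (size f <= m + m)%N ->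
    L f = \sum_(x <- s) (L (l x) : R) * f.[x].
  move=> szf; have szqm : size q = m.+1 by rewrite szq sm'.
  have q0 : q != 0 by rewrite monic_neq0.
  have szr : (size (f %% q)%R <= m)%N by rewrite -ltnS -szqm ltn_modp.
  have szd : (size (f %/ q)%R <= m)%N by rewrite size_divp // szqm leq_subLR.
  rewrite {1}(divp_eq f q) linearD /= mulrC qL // add0r.
  rewrite {1}(interp _ szr) linear_sum; apply: eq_big_seq => x xs.
  rewrite linearZ /= [_ *: _]mulrC; congr (_ * _).
  rewrite [in RHS](divp_eq f q) hornerD hornerM.
  suff /rootP -> : root q x by rewrite mulr0 add0r.
  by rewrite root_prod_XsubC.
exists s, (fun x => L (l x)); split; rewrite ?sm' //.
move=> x xs.
(* The square agrees with [l x] at all nodes and is small enough for the rule to be exact; this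
   exhibits the weight as the integral of a square. *)
have -> : L (l x) = L (l x ^+ 2).
  rewrite [RHS]quad; last first.
    by rewrite expr2 (leq_trans (size_polyMleq _ _)) // (leq_trans (leq_pred _)) // leq_add ?szl.
  rewrite (bigD1_seq x) //= horner_exp lE // eqxx expr1n mulr1 big1_seq ?addr0 //.
  by move=> y /andP[yx ys]; rewrite horner_exp lE // eq_sym (negPf yx) expr0n mulr0.
by apply: sumr_ge0 => j _; rewrite mulr_ge0 // horner_exp sqr_ge0.
Qed.

(** Weighting by [t j - lo] allows nodes in the interval open at [lo], so the Gauss weights can be
    divided back by [x - lo]. *)
Lemma gauss_radau_quadrature (R : rcfType) (n m : nat) (lo hi : R)
    (c t : 'I_n -> R) :
  (forall j, 0 <= c j) -> (forall j, t j \in `[lo, hi]) ->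
  exists (s : seq R) (w : R -> R),
    [/\ (size s <= m)%N, {subset s <= `]lo, hi]},
        {in lo :: s, forall x, 0 <= w x}
      & forall f : {poly R}, (size f <= (m + m).+1)%N ->
          \sum_j c j * f.[t j] = \sum_(x <- lo :: s) w x * f.[x]].
Proof.
move=> c0 tI.
have d0 j : 0 <= c j * (t j - lo).
  by rewrite mulr_ge0 // subr_ge0; have := tI j; rewrite in_itv => /andP[].
have [||s [v [us sm sI v0 vE]]] :=
    @gauss_quadrature R (mem `]lo, hi]) n m _ t _ d0.
- move=> x y z; rewrite !in_itv /= => /andP[lx _] /andP[_ yh] /andP[xz zy].
  by rewrite (lt_le_trans lx) // (le_trans zy).
- move=> j; rewrite mulf_eq0 negb_or subr_eq0 => /andP[_ tl].
  have := tI j; rewrite !in_itv /= => /andP[lt ->]; rewrite andbT.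
  by rewrite lt_neqAle eq_sym tl.
have slo x : x \in s -> lo < x by move=> /sI; rewrite in_itv => /andP[].
(* The mass left over for [lo], forced by exactness on constants; its sign is not evident from this
   formula. *)
pose w0 := \sum_j c j - \sum_(x <- s) v x / (x - lo).
pose w x := if x == lo then w0 else v x / (x - lo).
have ws x : x \in s -> w x = v x / (x - lo).
  by move=> xs; rewrite /w gt_eqF // slo.
have wlo : w lo = w0 by rewrite /w eqxx.
have wE (f : {poly R}) : (size f <= (m + m).+1)%N ->
    \sum_j c j * f.[t j] = \sum_(x <- lo :: s) w x * f.[x].
  move=> szf.
  (* Write [f] as [f.[lo]] plus [('X - lo%:P) * g]: the constant is handled by the choice of [w0],
     and [g] by the Gauss rule. *)
  have /factor_theorem[g gE] : root (f - f.[lo]%:P) lo.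
    by rewrite rootE !hornerE subrr.
  have fE x : f.[x] = f.[lo] + (x - lo) * g.[x].
    have := congr1 (horner^~ x) gE; rewrite !hornerE => h.
    by rewrite [_ * g.[x]]mulrC -h addrC subrK.
  have szg : (size g <= m + m)%N.
    have [->|g0] := eqVneq g 0; first by rewrite size_poly0.
    have : (size (f - f.[lo]%:P)%R <= (m + m).+1)%N.
      rewrite (leq_trans (size_polyD _ _)) // geq_max szf size_polyN.
      by rewrite (leq_trans (size_polyC_leq1 _)).
    by rewrite gE size_Mmonic ?monicXsubC // size_XsubC addn2.
  have -> : \sum_j c j * f.[t j] =
      f.[lo] * \sum_j c j + \sum_j c j * (t j - lo) * g.[t j].
    rewrite mulr_sumr -big_split /=; apply: eq_bigr => j _.
    by rewrite (fE (t j)); ring.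
  rewrite vE // big_cons wlo /w0.
  have -> : \sum_(x <- s) w x * f.[x] =
      f.[lo] * \sum_(x <- s) v x / (x - lo) + \sum_(x <- s) v x * g.[x].
    rewrite mulr_sumr -big_split /=; apply: eq_big_seq => x xs.
    rewrite ws // (fE x) mulrDr; congr (_ + _); first by rewrite mulrC.
    by rewrite mulrA divfK // subr_eq0 gt_eqF // slo.
  ring.
exists s, w; split=> //; move=> x; rewrite inE => /predU1P[->|xs]; last first.
  by rewrite ws // divr_ge0 ?v0 // subr_ge0 ltW // slo.
(* Testing on the square of the nodal polynomial isolates the weight at [lo]. *)
pose q := \prod_(x <- s) ('X - x%:P).
have q2 : (size (q ^+ 2) <= (m + m).+1)%N.
  rewrite expr2 (leq_trans (size_polyMleq _ _)) // size_prod_XsubC addSn addnS /=.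
  by rewrite ltnS leq_add.
have := wE _ q2; rewrite big_cons [X in _ + X]big1_seq ?addr0; last first.
  move=> y /andP[_ ys]; have /rootP qy : root q y by rewrite root_prod_XsubC.
  by rewrite horner_exp qy expr0n mulr0.
have qlo : 0 < (q ^+ 2).[lo].
  rewrite horner_exp exprn_even_gt0 //= -rootE root_prod_XsubC.
  by apply/negP => /slo; rewrite ltxx.
rewrite -(pmulr_lge0 (w lo) qlo) => <-.
by apply: sumr_ge0 => j _; rewrite mulr_ge0 // horner_exp sqr_ge0.
Qed.

(** * From quadrature rules to points on the curve *)

(** Exactness on the constant [1] makes the new weights sum to one; exactness on each coordinate
    polynomial of the curve preserves the point. *)
Lemma poly_curve_quadrature (R : realType) (N : nat) (a : 'M[R]_(N, N.+1))
    (n : nat) (c t : 'I_n -> R) (s : seq R) (w : R -> R) :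
  \sum_j c j = 1 -> {in s, forall x, 0 <= w x} ->
  (forall f : {poly R}, (size f <= N.+1)%N ->
     \sum_j c j * f.[t j] = \sum_(x <- s) w x * f.[x]) ->
  convex_combination (fun j : 'I_(size s) => poly_curve a s`_j)
    (\sum_j c j *: poly_curve a (t j)).
Proof.
move=> c1 w0 wE; exists (fun j => w s`_j); split.
- by move=> j; rewrite w0 // mem_nth.
- have := wE 1; rewrite size_poly1 => /(_ isT).
  under eq_bigr do rewrite hornerC mulr1.
  under [X in _ = X -> _]eq_bigr do rewrite hornerC mulr1.
  by rewrite c1 (big_nth 0) big_mkord => <-.
apply/rowP => i; rewrite !summxE.
pose f := \sum_(k < N.+1) a i k *: 'X^k.
have szf : (size f <= N.+1)%N.
  apply: (leq_trans (size_sum _ _ _)); apply/bigmax_leqP => k _.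
  by rewrite (leq_trans (size_scale_leq _ _)) // size_polyXn.
have fE x : poly_curve a x 0 i = f.[x].
  rewrite mxE horner_sum; apply: eq_bigr => k _.
  by rewrite hornerZ hornerXn.
under eq_bigr do rewrite mxE fE.
under [RHS]eq_bigr do rewrite mxE fE.
by rewrite wE // (big_nth 0) big_mkord.
Qed.

Theorem mainTheorem2 (R : realType) (N : nat) (hN : (0 < N)%N)
    (tmin tmax : R) (ht : tmin <= tmax) (a : 'M[R]_(N, N.+1)) (x : 'rV[R]_N)
    (hx : convex_hull (poly_curve a @` `[tmin, tmax]) x) :
  [/\ odd N ->
        exists (k : nat) (p : 'I_k -> 'rV[R]_N),
          [/\ (k <= (N + 1) %/ 2)%N,
              forall j, (poly_curve a @` `[tmin, tmax]) (p j)
            & convex_combination p x],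
      ~~ odd N ->
        exists (k : nat) (p : 'I_k -> 'rV[R]_N),
          [/\ (k <= (N + 2) %/ 2)%N,
              forall j, (poly_curve a @` `[tmin, tmax]) (p j)
            & convex_combination p x]
    & ~~ odd N ->
        exists (k : nat) (p : 'I_k -> 'rV[R]_N),
          [/\ (k <= (N + 2) %/ 2)%N,
              forall j, (poly_curve a @` `[tmin, tmax]) (p j),
              exists j0, p j0 = poly_curve a tmin
            & convex_combination p x]].
Proof.
have [n [p [pA [c [c0 c1 xE]]]]] := hx.
have /choice[t tP] : forall j, exists u,
    u \in `[tmin, tmax] /\ poly_curve a u = p j.
  by move=> j; have [u uI up] := pA j; exists u.
have {xE} -> : x = \sum_j c j *: poly_curve a (t j).
  by rewrite xE; apply: eq_bigr => j _; rewrite (tP j).2.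
have tI j := (tP j).1.
(* For even [N] the version with the required point implies the one without it. *)
suff even_case : ~~ odd N ->
    exists (k : nat) (p : 'I_k -> 'rV[R]_N),
      [/\ (k <= (N + 2) %/ 2)%N,
          forall j, (poly_curve a @` `[tmin, tmax]) (p j),
          exists j0, p j0 = poly_curve a tmin
        & convex_combination p (\sum_j c j *: poly_curve a (t j))].
  split=> // [oN|/even_case[k [q [kN qA _ qx]]]]; last by exists k, q.
  (* For odd [N], [m = N.+1./2] gives [m + m = N.+1], exactly the size bound of the coordinate
     polynomials. *)
  have [|s [w [_ sm sI w0 wE]]] :=
      @gauss_quadrature R (mem `[tmin, tmax]) n N.+1./2 c t _ c0 (fun j _ => tI j).
    move=> u v z; rewrite !in_itv /= => /andP[lu _] /andP[_ vh] /andP[uz zv].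
    by rewrite (le_trans lu) // (le_trans zv).
  exists (size s), (fun j => poly_curve a s`_j); split.
  - by rewrite addn1 divn2.
  - by move=> j; exists s`_j => //; apply: sI; rewrite mem_nth.
  - apply: (poly_curve_quadrature _ c1 w0) => f szf.
    by apply: wE; rewrite addnn even_halfK //= oN.
move=> eN.
(* For even [N], [m = N./2] gives [(m + m).+1 = N.+1]; together with [tmin] there are at most
   [N./2 + 1] nodes. *)
have [s [w [sm sI w0 wE]]] := @gauss_radau_quadrature R n N./2 tmin tmax c t c0 tI.
exists (size (tmin :: s)), (fun j => poly_curve a (tmin :: s)`_j); split.
- by rewrite /= addn2 divn2.
- move=> j; exists (tmin :: s)`_j => //.
  have /predU1P[->|/sI] : (tmin :: s)`_j \in tmin :: s by rewrite mem_nth.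
    by rewrite /= in_itv /= lexx.
  by rewrite /= !in_itv /= => /andP[/ltW -> ->].
- by exists ord0.
- apply: (poly_curve_quadrature _ c1 w0) => f szf.
  by apply: wE; rewrite addnn even_halfK.
Qed.
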